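(* Let $a_1,\ldots,a_n\in\mathbb{R}$ be pairwise distinct, let $c_i>0$ for all $1\le i\le n-1$, and suppose $\chi_n=QR$ in $\mathbb{C}[\lambda,w]$ with $Q$ monic in $\lambda$ of $\lambda$-degree $d$, $1\le d\le n-1$. Let $S\subset\{1,\ldots,n\}$, $|S|=d$, be the subset with $Q(\lambda,0)=\prod_{i\in S}(\lambda+a_i)$, and let $\pi$ be the permutation of $\{1,\ldots,n\}$ with $a_{\pi(1)}>\cdots>a_{\pi(n)}$. Then the rank set $\pi^{-1}(S)$ is invariant under the map $r\mapsto n+1-r$.
   Context: Here $c_i=b_i^2$ with $b_i\in\mathbb{R}$, and $\chi_n(\lambda,w)=\det(\lambda I+A+wB)$, where $A=\operatorname{diag}(a_1,\ldots,a_n)$ and $B$ is the $n\times n$ symmetric tridiagonal matrix with zero diagonal and $B_{i,i+1}=B_{i+1,i}=b_i$. The polynomial $\chi_n$ depends on the $b_i$ only through the $c_i$. Since the $a_i$ are pairwise distinct and $\chi_n(\lambda,0)=\prod_{i=1}^n(\lambda+a_i)$, the subset $S$ in the statement exists and is unique. *)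

(* Defs.v *)
From mathcomp Require Import all_boot all_order all_algebra perm.
From mathcomp Require Import reals complex.

Set Implicit Arguments.
Unset Strict Implicit.
Unset Printing Implicit Defensive.

Import GRing.Theory.
Local Open Scope ring_scope.

(* C[lambda, w] is represented as {poly {poly R[i]}}: the outer variable 'X is *)
(* lambda, the inner variable 'X%:P is w.  Hence size, lead_coef and monic     *)
(* refer to lambda.                                                            *)

Definition real_const (R : realType) (x : R) : {poly {poly R[i]}} :=
  (x%:C)%C%:P%:P.

(* Indices start at 0: b i is the entry in positions (i, i.+1) and (i.+1, i),  *)
(* and only the values b 0, ..., b (n - 2) are used.                           *)
Definition tridiag (R : realType) (n : nat) (b : nat -> R) : 'M[R]_n :=
  \matrix_(i < n, j < n)
    if (j == i.+1 :> nat) then b i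
    else if (i == j.+1 :> nat) then b j
    else 0.

Definition chi (R : realType) (n : nat) (a : 'I_n -> R) (b : nat -> R) :
    {poly {poly R[i]}} :=
  \det ('X%:M + map_mx (@real_const R) (diag_mx (\row_i a i))
        + ('X%:P) *: map_mx (@real_const R) (tridiag n b)).

Definition at_w0 (R : realType) (Q : {poly {poly R[i]}}) : {poly R[i]} :=
  map_poly (fun q : {poly R[i]} => q.[0]) Q.

(* Main.v *)
Require Import Defs.
From mathcomp Require Import all_boot all_order all_algebra perm.
From mathcomp Require Import reals complex.
From mathcomp Require Import polyrcf ring lra zify.
From mathcomp Require Import boolp classical_sets topology normedtype derive.

Set Implicit Arguments.
Unset Strict Implicit.
Unset Printing Implicit Defensive.

Import Order.TTheory GRing.Theory Num.Theory.
Import numFieldNormedType.Exports.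
Local Open Scope ring_scope.

(** For real w the matrix A + w B is symmetric, and tridiagonal with nonzero
off-diagonal entries unless w = 0, in which case it is diagonal with distinct
entries. Hence chi(., w) has n distinct real roots z_0(w) < ... < z_(n-1)(w)
for every real w. This is proved by the Sturm argument: consecutive
characteristic polynomials of the leading blocks satisfy a three-term
recurrence, so their roots interlace strictly ([jacobi_interlacing]).

For real w, Q(., w) divides a product of distinct real linear factors, so Q
and its cofactor T have real coefficients ([real_factor]). Say that the rank k
is in Q at w if z_k(w) is a root of Q(., w). Choose points t_0 < ... < t_n
separating the roots z_k(w): then k is in Q at w if and only if Q(., w)
changes sign between t_k and t_(k+1) ([root_factor_alternating]). This
criterion is stable under small changes of w, so by connectedness of the real
line the set of ranks in Q does not depend on w ([root_rank_constant]). At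
w = 0, where z_k = - a (p k), it is the rank set of S.

The set is then read off at both ends of the line. Let D(v) = det(v I + B),
and let t_0 < ... < t_n separate the roots of D. In polar coordinates
(lambda, w) = (v u, u), chi(v u, u) has degree n in u with leading coefficient
D(v). Hence the degree in u of Q(t_j u, u) is the same for all j: the leading
coefficient of Q(v u, u) divides D(v), which does not vanish at t_j. So
Q(t_k u, u) Q(t_(k+1) u, u) has even degree in u and has the same sign for
u = x and u = - x, x large. For u = x the points t_j u separate the roots of
chi(., u) in increasing order, for u = - x in decreasing order. Therefore k is
in Q at x if and only if n - 1 - k is in Q at - x ([root_rank_rev]). *)

(** * Separating the real roots of a polynomial *)

Section RootSeparation.
Variable F : rcfType.
Implicit Types (p q r : {poly F}) (t z : nat -> F).

(** The values z 0, ..., z (n - 1) are strictly increasing; the other values of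
z are irrelevant. *)
Definition increasing_below (n : nat) (z : nat -> F) : Prop :=
  forall i j : nat, (i < j < n)%N -> z i < z j.

(** The polynomial p changes sign strictly between consecutive points among
t 0, ..., t n. *)
Definition alternating (n : nat) (p : {poly F}) (t : nat -> F) : Prop :=
  forall k : nat, (k < n)%N -> p.[t k] * p.[t k.+1] < 0.

(** The n + 1 points t and the n points z interlace:
t 0 < z 0 < t 1 < ... < z (n - 1) < t n. Stated as a comparison of every pair,
which is the form needed to find the sign of a product over all roots. *)
Definition separates (n : nat) (t z : nat -> F) : Prop :=
  forall i k : nat, (i < n)%N -> (k <= n)%N ->
    if (i < k)%N then z i < t k else t k < z i.

Lemma increasing_belowS n z :
  (forall i, (i.+1 < n)%N -> z i < z i.+1) -> increasing_below n z.
Proof.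
move=> h i j; elim: j => [|j IHj]; first by rewrite ltn0.
rewrite ltnS leq_eqVlt => /andP[/predU1P[->|ij] jn]; first exact: h.
by apply: lt_trans (h _ jn); apply: IHj; rewrite ij ltnW.
Qed.

Lemma increasing_below_le n z i j :
  increasing_below n z -> (i <= j < n)%N -> z i <= z j.
Proof.
move=> zi /andP[]; rewrite leq_eqVlt => /predU1P[->//|ij] jn.
by apply/ltW/zi; rewrite ij.
Qed.

Lemma alternating_roots n p t :
    increasing_below n.+1 t -> alternating n p t ->
  exists z, forall k, (k < n)%N -> root p (z k) /\ t k < z k < t k.+1.
Proof.
move=> ti palt.
suff /choice[z pz] : forall k, exists x, (k < n)%N -> root p x /\ t k < x < t k.+1.
  by exists z.
move=> k; case: (ltnP k n) => [kn|_]; last by exists 0.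
have [||x] := @poly_ivtoo _ p (t k) (t k.+1).
- by apply/ltW/ti; rewrite ltnSn ltnS.
- exact: palt.
by rewrite in_itv /= => tx px; exists x.
Qed.

Lemma between_separates n t z :
    increasing_below n.+1 t ->
    (forall k, (k < n)%N -> t k < z k < t k.+1) ->
  separates n t z.
Proof.
move=> ti tz i k lt_in le_kn; have /andP[tzi zti] := tz _ lt_in.
case: ltnP => ik.
  by apply: lt_le_trans zti _; apply: (increasing_below_le ti); rewrite ik.
by apply: le_lt_trans tzi; apply: (increasing_below_le ti); lia.
Qed.

Lemma separates_between n t z :
  separates n t z -> forall k, (k < n)%N -> t k < z k < t k.+1.
Proof.
move=> tz k kn; have := tz k k kn (ltnW kn); rewrite ltnn => ->.
by have := tz k k.+1 kn kn; rewrite ltnSn.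
Qed.

Lemma separates_increasing n t z : separates n t z -> increasing_below n z.
Proof.
move=> tz; apply: increasing_belowS => i iin.
have /andP[_ h] := separates_between tz (ltnW iin).
by have /andP[h' _] := separates_between tz iin; apply: lt_trans h h'.
Qed.

Lemma separates_increasing_sep n t z :
  separates n t z -> increasing_below n.+1 t.
Proof.
move=> tz; apply: increasing_belowS => i; rewrite ltnS => iin.
by have /andP[h h'] := separates_between tz iin; apply: lt_trans h h'.
Qed.

(** Separating points exist: midpoints, and one point beyond each end. *)
Lemma exists_separates n z :
  increasing_below n z -> exists t, separates n t z.
Proof.
move=> zi.
exists (fun k => if k is k'.+1 then
          if (k < n)%N then (z k' + z k) / 2 else z k' + 1 else z 0%N - 1).
move=> i [|k] lt_in le_kn /=.
  have := @increasing_below_le n z 0 i zi; rewrite lt_in => /(_ isT); lra.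
rewrite ltnS; case: (leqP i k) => ik.
  have zik : z i <= z k by apply: (increasing_below_le zi); rewrite ik.
  case: ltnP => kn; last by lra.
  have := zi k k.+1; rewrite ltnSn kn => /(_ isT); lra.
have kn : (k.+1 < n)%N by apply: leq_ltn_trans lt_in.
have zki : z k.+1 <= z i by apply: (increasing_below_le zi); rewrite ik.
rewrite kn; have := zi k k.+1; rewrite ltnSn kn => /(_ isT); lra.
Qed.

Lemma poly_eq_prod_roots n p z :
    size p = n.+1 -> increasing_below n z ->
    (forall k, (k < n)%N -> root p (z k)) ->
  p = lead_coef p *: \prod_(k < n) ('X - (z k)%:P).
Proof.
move=> sp zi pz; have -> : \prod_(k < n) ('X - (z k)%:P) =
    \prod_(x <- mkseq z n) ('X - x%:P).
  by rewrite big_map -(big_mkord predT (fun k => 'X - (z k)%:P)) /index_iota subn0.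
apply: all_roots_prod_XsubC; first by rewrite size_mkseq.
  by apply/allP => x /mapP[k]; rewrite mem_iota add0n => kn ->; apply: pz.
rewrite uniq_rootsE map_inj_in_uniq ?iota_uniq // => i j.
rewrite !mem_iota !add0n /= => lt_in jn zij.
case: (ltngtP i j) => // h.
  by have := zi i j; rewrite h jn zij ltxx => /(_ isT).
by have := zi j i; rewrite h lt_in zij ltxx => /(_ isT).
Qed.

(** In p (t k) * p (t k.+1) every linear factor contributes a positive number,
except for the root lying in the gap. *)
Lemma separates_alternating n p t z :
    size p = n.+1 -> (forall k, (k < n)%N -> root p (z k)) ->
  separates n t z -> alternating n p t.
Proof.
move=> sp pz tz k kn; rewrite (poly_eq_prod_roots sp (separates_increasing tz) pz).
have c0 : lead_coef p != 0 by rewrite lead_coef_eq0 -size_poly_eq0 sp.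
rewrite !hornerZ mulrACA -expr2 pmulr_rlt0; last first.
  by rewrite exprn_even_gt0.
rewrite !horner_prod -big_split /= (bigD1 (Ordinal kn)) //= !hornerXsubC.
have /andP[h1 h2] := separates_between tz kn.
rewrite pmulr_llt0; first by nra.
apply: prodr_gt0 => i ik; rewrite !hornerXsubC.
have := tz i k (ltn_ord i) (ltnW kn); have := tz i k.+1 (ltn_ord i) kn.
rewrite ltnS leq_eqVlt (negPf (ik : (i : nat) != k)) /=.
case: ifP => _ ? ?; nra.
Qed.

Lemma roots_unique n p z z' :
    size p = n.+1 -> increasing_below n z -> increasing_below n z' ->
    (forall k, (k < n)%N -> root p (z k)) ->
    (forall k, (k < n)%N -> root p (z' k)) ->
  forall k, (k < n)%N -> z k = z' k.
Proof.
move=> sp zi zi' pz pz'.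
have srt y : increasing_below n y -> sorted <%R (mkseq y n).
  move=> yi; apply/(sortedP 0) => i; rewrite size_mkseq => lt_in.
  by rewrite !nth_mkseq ?(ltnW lt_in) //; apply: yi; rewrite ltnSn.
have sub y y' : increasing_below n y -> (forall k, (k < n)%N -> root p (y k)) ->
    (forall k, (k < n)%N -> root p (y' k)) ->
    {subset mkseq y' n <= mkseq y n}.
  move=> yi py py' x /mapP[k]; rewrite mem_iota add0n => /py' /[swap] <-.
  rewrite (poly_eq_prod_roots sp yi py) rootZ; last first.
    by rewrite lead_coef_eq0 -size_poly_eq0 sp.
  rewrite /root horner_prod => /prodf_eq0[i _].
  rewrite hornerXsubC subr_eq0 => /eqP ->.
  by apply: map_f; rewrite mem_iota ltn_ord.
have eqz : mkseq z n = mkseq z' n.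
  apply: lt_sorted_eq (srt _ zi) (srt _ zi') _ => x.
  by apply/idP/idP; apply: sub.
by move=> k kn; rewrite -(nth_mkseq 0 z kn) eqz nth_mkseq.
Qed.

(** Two complementary factors of p have no common root among the n roots of p,
which are simple. *)
Lemma simple_root_factor n p q r z k :
    p = q * r -> size p = n.+1 -> increasing_below n z ->
    (forall i, (i < n)%N -> root p (z i)) -> (k < n)%N ->
  root q (z k) -> root r (z k) -> False.
Proof.
move=> pqr sp zi pz kn /factor_theorem[q' eq_q] /factor_theorem[r' eq_r].
have c0 : lead_coef p != 0 by rewrite lead_coef_eq0 -size_poly_eq0 sp.
have := poly_eq_prod_roots sp zi pz; rewrite (bigD1 (Ordinal kn)) //=.
set m := \prod_(i < n | _) _ => p_fact.
have Xz0 : 'X - (z k)%:P != 0 :> {poly F} by rewrite polyXsubC_eq0.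
have /(mulfI Xz0) eq_m : ('X - (z k)%:P) * (q' * r' * ('X - (z k)%:P)) =
    ('X - (z k)%:P) * (lead_coef p *: m).
  by rewrite -scalerAr -p_fact pqr eq_q eq_r; ring.
have := congr1 (horner^~ (z k)) eq_m; rewrite /= hornerM hornerXsubC subrr mulr0.
apply/eqP; rewrite eq_sym hornerZ mulf_neq0 // horner_prod.
apply/prodf_neq0 => i ik; rewrite hornerXsubC subr_eq0.
case: (ltngtP i k) => [h|h|h].
- by rewrite gt_eqF // zi // h.
- by rewrite lt_eqF // zi // h /=.
- by case/negP: ik; apply/eqP/val_inj.
Qed.

(** A factor q of p vanishes at the k-th root of p exactly when it changes sign
across the k-th gap. As p = q * r changes sign there, exactly one of q and r
does; that one vanishes at the root, and the other does not. *)
Lemma root_factor_alternating n p q r t z :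
    p = q * r -> size p = n.+1 ->
    increasing_below n.+1 t -> alternating n p t ->
    increasing_below n z -> (forall k, (k < n)%N -> root p (z k)) ->
  forall k, (k < n)%N -> root q (z k) = (q.[t k] * q.[t k.+1] < 0).
Proof.
move=> pqr sp ti palt zi pz k kn.
have [y py] := alternating_roots ti palt.
have ty := between_separates ti (fun k kn => (py k kn).2).
have zy := roots_unique sp zi (separates_increasing ty) pz (fun k kn => (py k kn).1).
have gap s : s %| p -> s.[t k] * s.[t k.+1] < 0 -> root s (z k).
  move=> sdvd salt; have tk : t k <= t k.+1 by apply/ltW/ti; rewrite ltnSn ltnS.
  have [x] := poly_ivtoo tk salt; rewrite in_itv /= => /andP[tx xt] sx.
  suff -> : z k = x by [].
  have := root_dvdp sdvd sx.
  rewrite (poly_eq_prod_roots sp zi pz) rootZ; last first.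
    by rewrite lead_coef_eq0 -size_poly_eq0 sp.
  rewrite /root horner_prod => /prodf_eq0[i _].
  rewrite hornerXsubC subr_eq0 => /eqP xi; rewrite xi; congr z.
  have := ty i k (ltn_ord i) (ltnW kn); have := ty i k.+1 (ltn_ord i) kn.
  rewrite -zy // -xi ltnS; case: (ltngtP i k) => // _ h1 h2.
    by have := lt_trans tx h2; rewrite ltxx.
  by have := lt_trans xt h1; rewrite ltxx.
have pk := palt k kn; rewrite pqr !hornerM mulrACA in pk.
have [q0|q0|q0] := ltgtP (q.[t k] * q.[t k.+1]) 0.
- by apply: gap => //; rewrite pqr dvdp_mulr.
- apply/negP => qz; apply: (simple_root_factor pqr sp zi pz kn qz).
  by apply: gap; [rewrite pqr dvdp_mull | rewrite pmulr_rlt0 in pk].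
- by rewrite q0 mul0r ltxx in pk.
Qed.
End RootSeparation.

(** * Determinants of matrices of linear polynomials *)

Section DetDegree.
Variable K : comNzRingType.

Lemma coef_mul_linear (p q : {poly K}) m :
  (size p <= m.+1)%N -> (size q <= 2)%N -> (p * q)`_m.+1 = p`_m * q`_1.
Proof.
move=> sp sq; have -> : q = q`_1 *: 'X + (q`_0)%:P.
  apply/polyP => -[|[|i]]; rewrite !coefE /= ?mulr0 ?mulr1 ?add0r ?addr0 //.
  by apply: nth_default; apply: leq_trans sq _.
rewrite mulrDr -scalerAr coefD coefZ coefMX coefMC [p`_m.+1]nth_default //=.
by rewrite !coefE /= mul0r !addr0 mulr1 mulrC.
Qed.

Lemma prod_linear n (f : 'I_n -> {poly K}) :
    (forall i, (size (f i) <= 2)%N) ->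
  (size (\prod_i f i)%R <= n.+1)%N /\ (\prod_i f i)`_n = \prod_i (f i)`_1.
Proof.
elim: n f => [|n IHn] f sf; first by rewrite !big_ord0 size_poly1 coef1.
rewrite !big_ord_recr /=; have [] := IHn (fun i => f (widen_ord (leqnSn n) i)).
  by move=> i; apply: sf.
move=> sp cp; rewrite coef_mul_linear // cp; split=> //.
apply: leq_trans (size_polyMleq _ _) _.
by rewrite -subn1 leq_subLR add1n (leq_trans (leq_add sp (sf ord_max))) // addn2.
Qed.

(** The determinant of an n x n matrix with entries of degree at most 1 has
degree at most n, and its coefficient of degree n is the determinant of the
matrix of coefficients of degree 1. *)
Lemma det_linear n (A : 'M[{poly K}]_n) :
    (forall i j, (size (A i j) <= 2)%N) ->
  (size (\det A) <= n.+1)%N /\ (\det A)`_n = \det (\matrix_(i, j) (A i j)`_1).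
Proof.
move=> sA; split.
  apply: (big_ind (fun p : {poly K} => (size p <= n.+1)%N)).
  - by rewrite size_poly0.
  - by move=> p q sp sq; apply: leq_trans (size_polyD _ _) _; rewrite geq_max sp.
  move=> s _; rewrite mulr_sign.
  by case: (odd_perm s); rewrite ?size_polyN;
    apply: (prod_linear (fun i => sA i (s i))).1.
rewrite coef_sum; apply: eq_bigr => s _.
have cprod : (\prod_i A i (s i))`_n = \prod_i (\matrix_(i, j) (A i j)`_1) i (s i).
  rewrite (prod_linear (fun i => sA i (s i))).2.
  by apply: eq_bigr => i _; rewrite mxE.
by rewrite !mulr_sign -cprod; case: (odd_perm s); rewrite ?coefN.
Qed.
End DetDegree.

(** * Jacobi matrices *)

Section Jacobi.

(** The n x n symmetric tridiagonal matrix with diagonal x 0, ..., x (n - 1)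
and off-diagonal entries y 0, ..., y (n - 2). The entries are indexed by nat,
so that the leading blocks of a Jacobi matrix are given by the same
sequences. *)
Definition jacobi (K : nzRingType) (x y : nat -> K) (n : nat) : 'M[K]_n :=
  \matrix_(i, j) if j == i then x i
                 else if (j == i.+1 :> nat) then y i
                 else if (i == j.+1 :> nat) then y j else 0.

Lemma map_jacobi (K L : nzRingType) (f : {rmorphism K -> L}) x y n :
  map_mx f (jacobi x y n) = jacobi (f \o x) (f \o y) n.
Proof.
by apply/matrixP => i j; rewrite !mxE; do !case: ifP => _ //; rewrite rmorph0.
Qed.

(** The three-term recurrence for leading principal minors: expansion along the
last row, then along the last column for the off-diagonal term. *)
Lemma det_jacobiSS (K : comNzRingType) (x y : nat -> K) n :
  \det (jacobi x y n.+2) =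
  x n.+1 * \det (jacobi x y n.+1) - y n ^+ 2 * \det (jacobi x y n).
Proof.
have bump_lt m i : (i < m)%N -> bump m i = i by rewrite /bump ltnNge => /negPf ->.
have bumpnn m : bump m m = m.+1 by rewrite /bump leqnn.
rewrite (expand_det_row _ ord_max) !big_ord_recr /= big1 ?add0r; last first.
  move=> i _; rewrite mxE -!val_eqE /=; have := ltn_ord i.
  by do !case: eqP => //=; try lia; rewrite ?mul0r.
rewrite addrC; congr (_ + _).
  rewrite mxE eqxx /cofactor -signr_odd addnn odd_double mul1r; congr (_ * \det _).
  by apply/matrixP => i j; rewrite !mxE -!val_eqE /= !bump_lt.
rewrite mxE -val_eqE /= ltn_eqF // ltn_eqF ?eqxx; last by lia.
rewrite expr2 -mulrA -mulrN; congr (_ * _).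
rewrite /cofactor (expand_det_col _ ord_max) big_ord_recr /= big1 ?add0r; last first.
  move=> i _; rewrite !mxE -!val_eqE /= bumpnn bump_lt; last by rewrite ltnS ltnW.
  by have := ltn_ord i; do !case: eqP => //=; try lia; rewrite ?mul0r.
rewrite !mxE -!val_eqE /= bumpnn bump_lt // eqxx gtn_eqF //.
have sign_dbl m : (-1) ^+ (m + m) = 1 :> K by rewrite -signr_odd addnn odd_double.
rewrite /cofactor addSn exprS !sign_dbl mulr1 mul1r mulN1r.
congr (- (_ * \det _)); apply/matrixP => i j; rewrite !mxE -!val_eqE /=.
by rewrite !(bump_lt n) // !bump_lt // ltnS ltnW.
Qed.

Lemma jacobi_size_monic (K : comNzRingType) (x y : nat -> K) n :
  let J := \det (jacobi (fun i => 'X + (x i)%:P) (fun i => (y i)%:P) n) in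
  size J = n.+1 /\ J \is monic.
Proof.
move=> J; suff [sJ cJ] : (size J <= n.+1)%N /\ J`_n = 1.
  have sJE : size J = n.+1.
    apply/eqP; rewrite eqn_leq sJ ltnNge; apply/negP => le_Jn.
    by move: cJ; rewrite nth_default // => /eqP; rewrite eq_sym oner_eq0.
  by split=> //; rewrite monicE /lead_coef sJE cJ.
rewrite /J; have [|sJ ->] := @det_linear _ n
    (jacobi (fun i => 'X + (x i)%:P) (fun i => (y i)%:P) n).
  move=> i j; rewrite mxE; do !case: ifP => _; rewrite ?size_XaddC ?size_poly0 //;
  exact: leq_trans (size_polyC_leq1 _) _.
split=> //; rewrite -[RHS](det1 K n); congr (\det _).
apply/matrixP => i j; rewrite !mxE eq_sym; do !case: ifP => _;
  by rewrite ?coefE /= ?addr0.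
Qed.

End Jacobi.

(** * Signs of polynomials at infinity *)

Section SignAtInfinity.
Variable F : rcfType.

Lemma sign_at_infinity (p : {poly F}) : p != 0 ->
  exists M, forall x, M <= x ->
    0 < lead_coef p * p.[x] /\ 0 < (-1) ^+ (size p).-1 * lead_coef p * p.[- x].
Proof.
move=> p0; exists (cauchy_bound p) => x Mx.
have gt0 (u v : F) : u != 0 -> Num.sg v = Num.sg u -> 0 < u * v.
  by move=> u0 e; rewrite -sgr_gt0 sgrM e -expr2 exprn_even_gt0 //= sgr_eq0.
have l0 : lead_coef p != 0 by rewrite lead_coef_eq0.
split; apply: gt0 => //.
- by apply: (sgp_pinftyP (ge_cauchy_bound p0)); rewrite in_itv /= Mx.
- by rewrite mulf_neq0 // signr_eq0.
- by apply: (sgp_minftyP (le_cauchy_bound p0)); rewrite in_itv /= lerN2.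
Qed.

(** A product of two polynomials of the same degree has even degree, hence the
same sign near both infinities. *)
Lemma same_sign_at_infinity (g h : {poly F}) :
    g != 0 -> size h = size g ->
  exists M, forall x, M <= x ->
    (g * h).[x] * (lead_coef g * lead_coef h) > 0 /\
    (g * h).[- x] * (lead_coef g * lead_coef h) > 0.
Proof.
move=> g0 eq_s; have h0 : h != 0 by rewrite -size_poly_eq0 eq_s size_poly_eq0.
have gh0 : g * h != 0 by rewrite mulf_neq0.
have [M hM] := sign_at_infinity gh0; exists M => x /hM [].
rewrite lead_coefM size_mul // eq_s addnn -subn2 -signr_odd.
have -> : odd ((size g).*2 - 2) = false by rewrite -[2%N]/(1.*2) -doubleB odd_double.
by rewrite mul1r ![_.[_] * _]mulrC.
Qed.

Lemma eventually_below (P : nat -> F -> Prop) m :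
    (forall k, (k < m)%N -> exists M, forall x, M <= x -> P k x) ->
  exists M, forall x, M <= x -> forall k, (k < m)%N -> P k x.
Proof.
elim: m => [|m IHm] h; first by exists 0.
have [M1 h1] := IHm (fun k km => h k (ltnW km)); have [M2 h2] := h m (ltnSn m).
exists (Num.max M1 M2) => x; rewrite ge_max => /andP[x1 x2] k.
rewrite ltnS leq_eqVlt => /predU1P[->|]; [exact: h2|exact: h1].
Qed.

Lemma poly_horner_eq0 (g : {poly F}) : (forall x, g.[x] = 0) -> g = 0.
Proof.
move=> g0; apply: contrapT => /eqP/sign_at_infinity[M /(_ M (lexx M))[]].
by rewrite g0 mulr0 ltxx.
Qed.

End SignAtInfinity.

(** * Real roots of Jacobi determinants *)

Section Sturm.
Variable F : rcfType.

Variables x y : nat -> F.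

Let J n := \det (jacobi (fun i => 'X + (x i)%:P) (fun i => (y i)%:P) n).

(** The roots z of J n.+1 are real and simple, and J n alternates on them. The
signs of J n at the two extreme roots are what makes the induction go through:
by the recurrence J n.+2 has the sign opposite to J n at every z k, which
forces one root of J n.+2 beyond each end in addition to those in the gaps. *)
Lemma jacobi_interlacing n :
    (forall i, (i < n)%N -> y i != 0) ->
  exists z, [/\ increasing_below n.+1 z,
    forall k, (k < n.+1)%N -> root (J n.+1) (z k),
    alternating n (J n) z,
    0 < (J n).[z n] & 0 < (-1) ^+ n * (J n).[z 0%N]].
Proof.
elim: n => [|n IHn] y0.
  exists (fun=> - x 0%N); split => //.
  - by move=> i [|j]; rewrite ?ltn0 ?ltnS ?ltn0 ?andbF.
  - move=> k _; rewrite /J det_mx11 mxE eqxx /root.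
    by rewrite !hornerE addNr.
  - by rewrite /J det_mx00 !hornerE.
  - by rewrite /J det_mx00 !hornerE.
have [|z [zi zr zalt zn z0]] := IHn; first by move=> i /ltnW; apply: y0.
have [sJ mJ] : size (J n.+2) = n.+3 /\ J n.+2 \is monic :=
  jacobi_size_monic x y n.+2.
have [M0 hM0] := sign_at_infinity (monic_neq0 mJ).
have [M [MM0 Mz0 Mzn]] : exists M, [/\ M0 <= M, - M < z 0%N & z n < M].
  exists (Num.max M0 (Num.max (1 - z 0%N) (1 + z n))).
  split; rewrite ?le_max ?lexx // 1?ltrNl lt_max; apply/orP; right.
    by rewrite lt_max; apply/orP; left; lra.
  by rewrite lt_max; apply/orP; right; lra.
have [JM JNM] := hM0 M MM0; rewrite (monicP mJ) mulr1 mul1r in JM JNM.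
rewrite sJ /= in JNM.
have Jz k : (k < n.+1)%N -> (J n.+2).[z k] = - (y n ^+ 2 * (J n).[z k]).
  move=> kn; rewrite {1}/J det_jacobiSS hornerD hornerM (eqP (zr k kn)) mulr0 add0r.
  by rewrite hornerN -rmorphXn hornerM hornerC.
have yn : 0 < y n ^+ 2 by rewrite exprn_even_gt0 //= y0.
(* J n.+2 alternates on - M < z 0 < ... < z n < M, giving its n + 2 roots. *)
pose t k := if k is k'.+1 then if (k' < n.+1)%N then z k' else M else - M.
have ti : increasing_below n.+3 t.
  apply: increasing_belowS => -[|i]; rewrite /t // !ltnS => lt_in.
  rewrite lt_in; case: ltnP => lt_in'; first by apply: zi; rewrite ltnSn.
  by have -> : i = n by lia.
have talt : alternating n.+2 (J n.+2) t.
  move=> [|i]; rewrite /t // !ltnS => lt_in.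
    rewrite Jz // mulrN oppr_lt0 mulrCA pmulr_rgt0 //.
    have := mulr_gt0 JNM z0; rewrite !exprS !mulN1r opprK.
    by rewrite mulrACA -expr2 sqrr_sign mul1r.
  rewrite lt_in Jz //; case: ltnP => lt_in'.
    rewrite Jz // mulrNN mulrACA pmulr_rlt0 ?(mulr_gt0 yn yn) //; exact: zalt.
  have -> : i = n by lia.
  by rewrite mulNr oppr_lt0 (mulr_gt0 (mulr_gt0 yn zn)).
have [w wP] := alternating_roots ti talt.
have tw := between_separates ti (fun k kn => (wP k kn).2).
have zw : separates n.+1 w z.
  move=> i k lt_in lt_kn.
  have := tw k i.+1 lt_kn (ltnW lt_in).
  by rewrite /t lt_in ltnS; case: (leqP k i).
have [sJ1 mJ1] : size (J n.+1) = n.+2 /\ J n.+1 \is monic :=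
   jacobi_size_monic x y n.+1.
exists w; split.
- exact: separates_increasing tw.
- by move=> k kn; case: (wP k kn).
- exact: separates_alternating sJ1 zr zw.
- rewrite (poly_eq_prod_roots sJ1 zi zr) (monicP mJ1) scale1r horner_prod.
  apply: prodr_gt0 => i _; rewrite hornerXsubC subr_gt0.
  by have := zw i n.+1 (ltn_ord i) (leqnn _); rewrite ltn_ord.
- rewrite (poly_eq_prod_roots sJ1 zi zr) (monicP mJ1) scale1r horner_prod.
  rewrite -[in X in X * _](card_ord n.+1) -prodr_const -big_split /=.
  apply: prodr_gt0 => i _; rewrite hornerXsubC mulN1r opprB subr_gt0.
  by have := zw i 0%N (ltn_ord i) (leq0n _).
Qed.

Lemma jacobi_real_roots n :
    (forall i, (i.+1 < n)%N -> y i != 0) ->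
  exists z, increasing_below n z /\ forall k, (k < n)%N -> root (J n) (z k).
Proof.
case: n => [|n] y0; first by exists (fun=> 0); split=> // i j; rewrite andbF.
by have [z [zi zr _ _ _]] := jacobi_interlacing y0; exists z.
Qed.
End Sturm.

(** * Specializations of bivariate polynomials *)

Section Specialization.
Variable F : fieldType.
Implicit Types (p q r : {poly {poly F}}) (t w x : F).

(** The specialization p(lambda, w) of the inner variable at a scalar w. *)
Definition at_w (w : F) (p : {poly {poly F}}) : {poly F} :=
  map_poly (horner_eval w) p.

Lemma at_wM w p q : at_w w (p * q) = at_w w p * at_w w q.
Proof. exact: rmorphM. Qed.

Lemma horner_at_w w p (x : {poly F}) : (at_w w p).[x.[w]] = p.[x].[w].
Proof. exact: (horner_map (horner_eval w)). Qed.

(** Polar coordinates: the polynomial p(v u, u), where the outer variable of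
the result is u and the inner one is v. *)
Definition polar (p : {poly {poly F}}) : {poly {poly F}} :=
  (map_poly (map_poly polyC) p).['X%:P * 'X].

Lemma polarM p q : polar (p * q) = polar p * polar q.
Proof. by rewrite /polar rmorphM hornerM. Qed.

Lemma at_w_polar t p : at_w t (polar p) = p.[t *: 'X].
Proof.
rewrite /at_w /polar -(horner_map (map_poly (horner_eval t))).
have -> : map_poly (map_poly (horner_eval t)) (map_poly (map_poly polyC) p) = p.
  apply/polyP => i; rewrite coef_map /= coef_map /=.
  by apply/polyP => j; rewrite coef_map /= coef_map /= /horner_eval hornerC.
by rewrite rmorphM /= map_polyX map_polyC /= /horner_eval hornerX mul_polyC.
Qed.

(** The degree of a factor of p is preserved wherever the leading coefficient of
p does not vanish. *)
Lemma size_at_w_factor t p q r :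
  p = q * r -> (lead_coef p).[t] != 0 -> size (at_w t q) = size q.
Proof.
move=> ->; rewrite lead_coefM hornerM mulf_eq0 negb_or => /andP[q0 _].
by rewrite /at_w size_map_poly_id0.
Qed.

End Specialization.

(** * The ranks of the roots of a factor *)

Section RankConstancy.
Variable R : realType.

Lemma near_horner_lt0 (g : {poly R}) (w : R) :
  g.[w] < 0 -> \forall u \near w, g.[u] < 0.
Proof. exact: (cvgr_lt g.[w] (@continuous_horner R g w)). Qed.

Lemma near_horner_sign (g : {poly R}) (w : R) :
  g.[w] != 0 -> \forall u \near w, (g.[u] < 0) = (g.[w] < 0).
Proof.
move=> g0; have [gw|gw] := ltP g.[w] 0.
  by near=> u; near: u; exact: near_horner_lt0.
have /near_horner_lt0 h : (- g).[w] < 0 by rewrite hornerN oppr_lt0 lt_def g0.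
near=> u; apply/negbTE; rewrite -leNgt ltW // -oppr_lt0 -hornerN.
by near: u.
Unshelve. all: by end_near. Qed.

Variables (n : nat) (p q r : {poly {poly R}}).
Hypothesis pqr : p = q * r.
Hypothesis size_p : forall w, size (at_w w p) = n.+1.

Let real_roots w z :=
  increasing_below n z /\ forall k, (k < n)%N -> root (at_w w p) (z k).

Hypothesis p_roots : forall w, exists z, real_roots w z.

(** Locally, whether the root of rank k belongs to the factor q does not depend
on the parameter: points separating the roots at w also do so near w, and the
sign of q at them does not change. *)
Lemma root_rank_near w z k : real_roots w z -> (k < n)%N ->
  \forall u \near w, forall y, real_roots u y ->
    root (at_w u q) (y k) = root (at_w w q) (z k).
Proof.
move=> [zi zr] kn; have [t tz] := exists_separates zi.
have ti := separates_increasing_sep tz.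
have talt := separates_alternating (size_p w) zr tz.
pose gap (s : {poly {poly R}}) i := s.[(t i)%:P] * s.[(t i.+1)%:P].
have gapE s u i : (gap s i).[u] = (at_w u s).[t i] * (at_w u s).[t i.+1].
  by rewrite /gap hornerM -!horner_at_w !hornerC.
have gap0 : (gap q k).[w] != 0.
  have := talt k kn; rewrite -gapE /gap pqr !hornerM.
  by apply: contraTneq; rewrite mulrACA => ->; rewrite mul0r ltxx.
have near_p : \forall u \near w, forall i : 'I_n, (gap p i).[u] < 0.
  apply: (@filter_forall _ 'I_n (fun i u => (gap p i).[u] < 0) _ (nbhs_filter w)) => i.
  apply: near_horner_lt0.
  by rewrite gapE; exact: talt.
near=> u => y [yi yr].
have gap_u : forall i : 'I_n, (gap p i).[u] < 0 by near: u.
have ualt : alternating n (at_w u p) t.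
  by move=> i lt_in; rewrite -gapE; exact: (gap_u (Ordinal lt_in)).
rewrite (root_factor_alternating _ (size_p u) ti ualt yi yr kn (r := at_w u r));
  last by rewrite pqr at_wM.
rewrite (root_factor_alternating _ (size_p w) ti talt zi zr kn (r := at_w w r));
  last by rewrite pqr at_wM.
by rewrite -!gapE; near: u; exact: near_horner_sign.
Unshelve. all: by end_near. Qed.

(** The previous lemma made global: the indicator of the event that the root of
rank k belongs to q is continuous on the real line, so the intermediate value
theorem makes it constant. *)
Lemma root_rank_constant w w' z z' k :
    real_roots w z -> real_roots w' z' -> (k < n)%N ->
  root (at_w w q) (z k) = root (at_w w' q) (z' k).
Proof.
move=> zP zP' kn; have [y yP] := choice p_roots.
have yq u x : real_roots u x -> root (at_w u q) (x k) = root (at_w u q) (y u k).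
  move=> [xi xr]; have [yi yr] := yP u.
  by rewrite (roots_unique (size_p u) xi yi xr yr kn).
(* The sorted roots are unique, so a fixed choice y of them may be used. *)
rewrite (yq _ _ zP) (yq _ _ zP') => {z z' zP zP'}.
wlog le_ww' : w w' / w <= w'.
  move=> wl; case: (leP w w') => [/wl//|/ltW/wl <- //].
pose f u : R := (root (at_w u q) (y u k))%:R.
have fcont : {within `[w, w'], continuous f}%classic.
  apply: continuous_subspaceT => u; apply: cvg_near_cst.
  near=> v; rewrite /f; congr (_%:R); congr nat_of_bool.
  move: (yP v); move: (y v); near: v; exact: root_rank_near.
apply: contrapT => f_neq.
have [|c _] := @IVT _ f w w' 2^-1 le_ww' fcont.
  rewrite /f; move: f_neq; case: root; case: root => //= _.
    by rewrite /Num.min /Num.max ltr10 /=; lra.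
  by rewrite /Num.min /Num.max ltr01 /=; lra.
rewrite /f; case: root => /= h; exfalso; lra.
Unshelve. all: by end_near. Qed.

(* The points t separate the asymptotic slopes lambda / w of the roots of p. *)
Variable t : nat -> R.
Hypothesis t_incr : increasing_below n.+1 t.
Hypothesis t_alt : alternating n (lead_coef (polar p)) t.
Hypothesis t_neq0 : forall k, (k < n.+1)%N -> (lead_coef (polar p)).[t k] != 0.

(** The set of ranks of the roots of a factor is symmetric. The points t i * x
separate the roots at a large parameter x; at - x the points t i * - x do so in
the opposite order. *)
Lemma root_rank_rev w z k : real_roots w z -> (k < n)%N ->
  root (at_w w q) (z k) = root (at_w w q) (z (n.-1 - k)%N).
Proof.
move=> zP kn.
have polar_pqr : polar p = polar q * polar r by rewrite pqr polarM.
have on_ray (s : {poly {poly R}}) u i : (at_w u s).[t i * u] = (at_w (t i) (polar s)).[u].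
  by rewrite at_w_polar -horner_at_w !hornerE.
have lead_neq0 s s' i : (i < n.+1)%N -> polar p = s * s' ->
    (lead_coef s).[t i] != 0.
  move=> lt_in ps; have := t_neq0 lt_in.
  by rewrite ps lead_coefM hornerM mulf_eq0 negb_or => /andP[].
have lead_ray s s' i : (i < n.+1)%N -> polar p = s * s' ->
    lead_coef (at_w (t i) s) = (lead_coef s).[t i].
  move=> lt_in ps; apply: lead_coef_map_id0; first exact: horner0.
  exact: lead_neq0 lt_in ps.
have size_ray s s' i : (i < n.+1)%N -> polar p = s * s' ->
    size (at_w (t i) s) = size s.
  by move=> lt_in ps; apply: size_at_w_factor ps _; exact: t_neq0.
have sep s s' i : polar p = s * s' -> (i < n)%N ->
    exists M, forall x, M <= x ->
      let g := (lead_coef s).[t i] * (lead_coef s).[t i.+1] in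
      let h := at_w (t i) s * at_w (t i.+1) s in
      h.[x] * g > 0 /\ h.[- x] * g > 0.
  move=> ps lt_in; have lt_in' : (i < n.+1)%N by exact: ltnW.
  rewrite /= -(lead_ray _ _ _ lt_in' ps) -(lead_ray _ _ i.+1 lt_in ps).
  apply: same_sign_at_infinity; last first.
    by rewrite (size_ray _ _ _ lt_in' ps) (size_ray _ _ i.+1 lt_in ps).
  by rewrite -lead_coef_eq0 (lead_ray _ _ _ lt_in' ps) (lead_neq0 _ _ _ lt_in' ps).
(* One parameter x that is large enough for all gaps, for both p and q. *)
have [M1 h1] := eventually_below (fun i => sep _ _ i polar_pqr).
have [M2 h2] := eventually_below (fun i => sep _ 1 i (esym (mulr1 _))).
pose x := Num.max 1 (Num.max M1 M2).
have x_gt0 : 0 < x by rewrite lt_max ltr01.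
have M1x : M1 <= x by rewrite !le_max lexx !orbT.
have M2x : M2 <= x by rewrite !le_max lexx !orbT.
have {}h1 := h1 x M1x; have {}h2 := h2 x M2x.
have lt0E (g h : R) : 0 < g * h -> (g < 0) = (h < 0).
  by move=> gh; apply/idP/idP => lt0; move: gh;
    rewrite ?(nmulr_rgt0 _ lt0) ?(nmulr_lgt0 _ lt0).
have p_lt0 k' u : (k' < n)%N -> u = x \/ u = - x ->
    (at_w u p).[t k' * u] * (at_w u p).[t k'.+1 * u] < 0.
  move=> kn' ux; rewrite !on_ray -hornerM (lt0E _ ((lead_coef (polar p)).[t k'] *
    (lead_coef (polar p)).[t k'.+1])); first exact: t_alt.
  by have [] := h2 k' kn'; case: ux => ->.
have q_lt0 k' u : (k' < n)%N -> u = x \/ u = - x ->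
    ((at_w u q).[t k' * u] * (at_w u q).[t k'.+1 * u] < 0) =
    ((lead_coef (polar q)).[t k'] * (lead_coef (polar q)).[t k'.+1] < 0).
  move=> kn' ux; rewrite !on_ray -hornerM; apply: lt0E.
  by have [] := h1 k' kn'; case: ux => ->.
have [y [yi yr]] := p_roots x; have [y' [yi' yr']] := p_roots (- x).
have eq_pos k' : (k' < n)%N -> root (at_w x q) (y k') =
    ((lead_coef (polar q)).[t k'] * (lead_coef (polar q)).[t k'.+1] < 0).
  move=> kn'; rewrite -(q_lt0 k' x kn'); last by left.
  apply: (root_factor_alternating (r := at_w x r) (t := fun i => t i * x) _ (size_p x)) => //.
  - by rewrite pqr at_wM.
  - by move=> i j ij; rewrite ltr_pM2r // t_incr.
  - by move=> i lt_in; apply: p_lt0 => //; left.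
have eq_neg : root (at_w (- x) q) (y' (n.-1 - k)%N) =
    ((lead_coef (polar q)).[t k] * (lead_coef (polar q)).[t k.+1] < 0).
  rewrite -(q_lt0 k (- x) kn); last by right.
  rewrite (root_factor_alternating (r := at_w (- x) r)
    (t := fun i => t (n - i)%N * - x) _ (size_p (- x))) => //.
  - rewrite mulrC; congr (_.[t _ * _] * _.[t _ * _] < 0); lia.
  - by rewrite pqr at_wM.
  - move=> i j /andP[ij jn]; rewrite ltr_nM2r ?oppr_lt0 //; apply: t_incr; lia.
  - move=> i lt_in; rewrite mulrC -(subnSK lt_in); apply: p_lt0; last by right.
    by rewrite subnSK // leq_subr.
  - lia.
rewrite (root_rank_constant zP (conj yi yr) kn) eq_pos // -eq_neg.
by rewrite (root_rank_constant zP (conj yi' yr')) //; lia.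
Qed.

End RankConstancy.

(** * Factors of a real-rooted family are real *)

Section RealFactor.
Variable R : realType.

(** The inclusion of R[w][lambda] into C[w][lambda]. *)
Definition complexify (p : {poly {poly R}}) : {poly {poly R[i]}} :=
  map_poly (map_poly (real_complex R)) p.

Lemma complexify_inj : injective complexify.
Proof.
have inj : injective (map_poly (real_complex R)).
  by apply: map_inj_poly => // x y [].
by apply: map_inj_poly => //; rewrite rmorph0.
Qed.

Lemma at_w_complexify w p :
  at_w (w%:C)%C (complexify p) = map_poly (real_complex R) (at_w w p).
Proof.
apply/polyP => i; rewrite /at_w /complexify !coef_map /= /horner_eval.
exact: horner_map.
Qed.

Lemma Im_horner (g : {poly R[i]}) (w : R) :
  complex.Im g.[(w%:C)%C] = (map_poly (@complex.Im R) g).[w].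
Proof.
have gE : g = map_poly (real_complex R) (map_poly (@complex.Re R) g) +
    'i%C *: map_poly (real_complex R) (map_poly (@complex.Im R) g).
  apply/polyP => i; rewrite coefD coefZ !coef_map_id0 //=.
  exact: complexE.
by rewrite {1}gE hornerD hornerZ !(horner_map (real_complex R)) /= !mul0r mul1r !add0r.
Qed.

(** A monic complex factor of a family p(., w), w real, with only real roots is
real: for every real w it is a product of real linear factors, so the imaginary
parts of its coefficients vanish for all real w. *)
Lemma real_factor n (p : {poly {poly R}}) (Q T : {poly {poly R[i]}}) :
    (forall w, size (at_w w p) = n.+1) -> (forall w, at_w w p \is monic) ->
    (forall w, exists z, increasing_below n z /\
       forall k, (k < n)%N -> root (at_w w p) (z k)) ->
    complexify p = Q * T -> Q \is monic ->
  exists q, Q = complexify q.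
Proof.
move=> sp mp p_roots pQT mQ.
have real_w w : exists g, at_w (w%:C)%C Q = map_poly (real_complex R) g.
  have [z [zi zr]] := p_roots w.
  have pE : at_w (w%:C)%C (complexify p) =
      \prod_(k < n) ('X - ((z k)%:C)%C%:P).
    rewrite at_w_complexify (poly_eq_prod_roots (sp w) zi zr).
    rewrite (monicP (mp w)) scale1r rmorph_prod; apply: eq_bigr => k _.
    by rewrite rmorphB /= map_polyX map_polyC.
  have : at_w (w%:C)%C Q %| \prod_(k < n) ('X - ((z k)%:C)%C%:P).
    by rewrite -pE pQT at_wM dvdp_mulr.
  case/dvdp_prod_XsubC => m; rewrite eqp_monic ?monic_prod_XsubC ?monic_map //.
  move=> /eqP ->; exists (\prod_(k <- mask m (index_enum 'I_n)) ('X - (z k)%:P)).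
  by rewrite rmorph_prod; apply: eq_bigr => k _; rewrite rmorphB /= map_polyX map_polyC.
have Im0 i : map_poly (@complex.Im R) Q`_i = 0.
  apply: poly_horner_eq0 => w; rewrite -Im_horner.
  have [g /(congr1 (fun u : {poly R[i]} => u`_i))] := real_w w.
  by rewrite /at_w !coef_map /= /horner_eval => ->.
exists (map_poly (map_poly (@complex.Re R)) Q).
apply/polyP => i; rewrite !coef_map; apply/polyP => j.
have := congr1 (fun u : {poly R} => u`_j) (Im0 i); rewrite !coef_map /= coef0.
by case: (_`_j) => u v /= ->.
Qed.

End RealFactor.

(** * The pencil of Jacobi matrices *)

Section JacobiPencil.
Variable R : realType.
Variables (a b : nat -> R).

(** The real polynomial det(lambda I + A + w B), with lambda as outer variable
and w as inner one. *)
Definition pencil (n : nat) : {poly {poly R}} :=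
  \det (jacobi (fun i => 'X + ((a i)%:P)%:P) (fun i => (b i *: 'X)%:P) n).

Lemma at_w_pencil w n :
  at_w w (pencil n) =
  \det (jacobi (fun i => 'X + (a i)%:P) (fun i => (b i * w)%:P) n).
Proof.
rewrite /at_w /pencil -det_map_mx map_jacobi; congr (\det _).
apply/matrixP => i j; rewrite !mxE /=.
rewrite rmorphD /= map_polyX !map_polyC /= /horner_eval !hornerE.
by [].
Qed.

Lemma at_w_pencil_size_monic w n :
  size (at_w w (pencil n)) = n.+1 /\ at_w w (pencil n) \is monic.
Proof. by rewrite at_w_pencil; apply: jacobi_size_monic. Qed.

Lemma at_w0_pencil n :
  at_w 0 (pencil n) = \prod_(i < n) ('X + (a i)%:P).
Proof.
rewrite at_w_pencil -[RHS]/(\prod_(i < n) (fun k : nat => 'X + (a k)%:P) i).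
rewrite (_ : jacobi _ _ _ = diag_mx (\row_(i < n) ('X + (a i)%:P))).
  by rewrite det_diag; apply: eq_bigr => i _; rewrite mxE.
apply/matrixP => i j; rewrite !mxE eq_sym; case: eqP => [->|_]; first by rewrite mulr1n.
by rewrite mulr0n !mulr0 polyC0 !if_same.
Qed.

Lemma pencil_roots w n : w != 0 -> (forall i, (i.+1 < n)%N -> b i != 0) ->
  exists z, increasing_below n z /\
    forall k, (k < n)%N -> root (at_w w (pencil n)) (z k).
Proof.
move=> w0 b0; rewrite at_w_pencil; apply: jacobi_real_roots => i lt_in.
by rewrite mulf_neq0 // b0.
Qed.

(** The leading coefficient in u of det(v u I + A + u B) is det(v I + B). The
zero diagonal of B is written explicitly, so that the right-hand side has the
form to which the lemmas on real roots of Jacobi determinants apply. *)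
Lemma lead_coef_polar_pencil n :
  lead_coef (polar (pencil n)) =
  \det (jacobi (fun=> 'X + 0%:P) (fun i => (b i)%:P) n).
Proof.
have -> : polar (pencil n) = \det (jacobi
    (fun i => ('X : {poly R})%:P * 'X + ((a i)%:P)%:P) (fun i => (b i)%:P *: 'X) n).
  rewrite -[LHS]/(horner_eval ('X%:P * 'X : {poly {poly R}})
    (map_poly (map_poly polyC) (pencil n))).
  rewrite /pencil -!det_map_mx !map_jacobi; congr (\det _).
  apply/matrixP => i j; rewrite !mxE /= /horner_eval.
  rewrite rmorphD /= map_polyX !map_polyC /= !hornerE.
  have bE k : map_poly polyC (b k *: 'X) = (b k)%:P *: 'X by rewrite map_polyZ map_polyX.
  by rewrite map_polyC /= !bE.
set A := jacobi _ _ _; have [|sA cA] := @det_linear _ n A.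
  move=> i j; rewrite mxE.
  case: ifP => _.
    rewrite (leq_trans (size_polyD _ _)) // geq_max.
    by rewrite mul_polyC (leq_trans (size_scale_leq _ _)) ?size_polyX ?(leq_trans (size_polyC_leq1 _)).
  do !case: ifP => _; by rewrite ?size_poly0 // (leq_trans (size_scale_leq _ _)) ?size_polyX.
have cE : (\det A)`_n = \det (jacobi (fun=> 'X + 0%:P) (fun i => (b i)%:P) n).
  rewrite cA; congr (\det _); apply/matrixP => i j; rewrite !mxE.
  by do !case: ifP => _; rewrite ?coefE /= ?mulr1 ?addr0.
have [sD mD] := jacobi_size_monic (fun=> 0 : R) b n.
have sAE : size (\det A) = n.+1.
  apply/eqP; rewrite eqn_leq sA ltnNge; apply/negP => /(nth_default 0) c0.
  by move: sD; rewrite -cE c0 size_poly0.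
by rewrite lead_coefE sAE.
Qed.

End JacobiPencil.

Lemma chi_complexify (R : realType) n (a : 'I_n -> R) (a' b : nat -> R) :
  (forall i : 'I_n, a' i = a i) -> chi a b = complexify (pencil a' b n).
Proof.
move=> aE; rewrite /complexify /pencil -det_map_mx map_jacobi.
congr (\det _); apply/matrixP => i j; rewrite !mxE /= eq_sym.
have rc0 : real_const (0 : R) = 0 by rewrite /real_const !rmorph0.
have bE k : map_poly (real_complex R) (b k *: 'X) = 'X * (real_complex R (b k))%:P.
  by rewrite map_polyZ map_polyX -mul_polyC mulrC.
rewrite rmorphD /= map_polyX !map_polyC /= !map_polyC /=.
case: eqP => [->|ij].
  by rewrite !mulr1n aE !ltn_eqF // rc0 mulr0 addr0.
rewrite !mulr0n rc0 !add0r !bE.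
by do !case: ifP => _; rewrite ?rc0 ?mulr0 ?polyCM.
Qed.

(** * Symmetry of the rank set *)

Theorem proposition6p7 (R : realType) (n : nat)
    (a : 'I_n -> R) (b c : nat -> R)
    (a_inj : injective a)
    (c_def : forall i : nat, (i.+1 < n)%N -> c i = b i ^+ 2)
    (c_gt0 : forall i : nat, (i.+1 < n)%N -> 0 < c i)
    (Q T : {poly {poly R[i]}})
    (chi_fact : chi a b = Q * T)
    (d : nat)
    (Q_monic : Q \is monic)
    (Q_deg : size Q = d.+1)
    (d_bounds : (1 <= d <= n.-1)%N)
    (S : {set 'I_n})
    (S_card : #|S| = d)
    (S_def : at_w0 Q = \prod_(i in S) ('X + ((a i)%:C)%C%:P))
    (p : 'S_n)
    (p_sorts : forall i j : 'I_n, (i < j)%N -> a (p j) < a (p i)) :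
  [set rev_ord r | r in p @^-1: S] = p @^-1: S.
Proof.
have b_neq0 i : (i.+1 < n)%N -> b i != 0.
  by move=> lt_in; rewrite -(sqrf_eq0 (b i)) -c_def // gt_eqF ?c_gt0.
(* The default value 0 outside of 'I_n is never used. *)
pose a' k := oapp a 0 (insub k : option 'I_n).
have aE (i : 'I_n) : a' i = a i by rewrite /a' valK.
pose P := pencil a' b n; have chiE : chi a b = complexify P := chi_complexify b aE.
have sP w : size (at_w w P) = n.+1 := (at_w_pencil_size_monic a' b w n).1.
have mP w : at_w w P \is monic := (at_w_pencil_size_monic a' b w n).2.
have P_monic : P \is monic.
  exact: (jacobi_size_monic (fun i => (a' i)%:P) (fun i => b i *: 'X) n).2.
(* The sorted roots at w = 0 are - a (p 0) < - a (p 1) < ..., because p sorts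
   the values of a in decreasing order. *)
pose z0 k := oapp (fun i => - a (p i)) 0 (insub k : option 'I_n).
have z0E (i : 'I_n) : z0 i = - a (p i) by rewrite /z0 valK.
have z0P : increasing_below n z0 /\
    forall k, (k < n)%N -> root (at_w 0 P) (z0 k).
  split=> [i j /andP[ij jn]|k kn].
    rewrite (z0E (Ordinal (ltn_trans ij jn))) (z0E (Ordinal jn)) ltrN2.
    exact: p_sorts.
  rewrite (z0E (Ordinal kn)) /P at_w0_pencil (bigD1 (p (Ordinal kn))) //=.
  by rewrite rootM /root !hornerE aE addNr eqxx.
have P_roots w : exists z, increasing_below n z /\
    forall k, (k < n)%N -> root (at_w w P) (z k).
  have [->|w0] := eqVneq w 0; first by exists z0.
  exact: pencil_roots.
have [q Qq] : exists q, Q = complexify q.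
  by apply: (real_factor sP mP P_roots _ Q_monic (T := T)); rewrite -chiE.
have T_monic : T \is monic.
  by rewrite -(monicMl _ Q_monic) -chi_fact chiE monic_map.
have [r Tr] : exists r, T = complexify r.
  by apply: (real_factor sP mP P_roots _ T_monic (T := Q)); rewrite -chiE mulrC.
have Pqr : P = q * r.
  apply: complexify_inj; rewrite -chiE chi_fact Qq Tr.
  by rewrite /complexify rmorphM.
have q0E : at_w 0 q = \prod_(i in S) ('X + (a i)%:P).
  apply: (map_inj_poly (f := real_complex R)) => // [x y []//|].
  rewrite rmorph_prod -at_w_complexify -Qq -[LHS]/(at_w0 Q) S_def.
  by apply: eq_bigr => i _; rewrite rmorphD /= map_polyX map_polyC.
have mem_S (k : 'I_n) : (k \in p @^-1: S) = root (at_w 0 q) (z0 k).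
  rewrite inE q0E z0E /root horner_prod; apply/idP/prodf_eq0 => [pk|[i iS]].
    by exists (p k); rewrite // !hornerE addNr.
  by rewrite !hornerE addrC subr_eq0 => /eqP/a_inj <-.
(* The points t separate the roots of det(v I + B). *)
pose D := \det (jacobi (fun=> 'X + (0 : R)%:P) (fun i => (b i)%:P) n).
have leadP : lead_coef (polar P) = D := lead_coef_polar_pencil a' b n.
have [sD mD] : size D = n.+1 /\ D \is monic := jacobi_size_monic (fun=> 0) b n.
have [x [xi xr]] := @jacobi_real_roots _ (fun=> 0) b n b_neq0.
have [t tx] := exists_separates xi.
have t_alt : alternating n D t := separates_alternating sD xr tx.
have n_gt0 : (0 < n)%N by lia.
have t_neq0 k : (k < n.+1)%N -> D.[t k] != 0.
  case: k => [_|k kn]; [have := t_alt 0%N n_gt0|have := t_alt k kn];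
  by apply: contraTneq => ->; rewrite ?mul0r ?mulr0 ltxx.
rewrite -leadP in t_alt t_neq0.
have rev_mem (k : 'I_n) : (rev_ord k \in p @^-1: S) = (k \in p @^-1: S).
  rewrite !mem_S (root_rank_rev Pqr sP P_roots (separates_increasing_sep tx)
    t_alt t_neq0 z0P (ltn_ord k)).
  by congr (root _ (z0 _)); rewrite /=; lia.
apply/setP => k; rewrite -[k in LHS]rev_ordK mem_imset; last exact: rev_ord_inj.
exact: rev_mem.
Qed.
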